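(* Let the algorithm described in the context be applied to $f$ on $D$ with the maximal allowed number of trial points $T_{max}=\infty$, so that it does not stop and generates an infinite sequence of trial points $\{x^{j(k)}\}$. Then for any point $x\in D$ and any $\delta>0$ there exist an iteration number $k(\delta)\ge1$ and a point $x'$ which, for every $k>k(\delta)$, belongs to the set $\{x^{j(k)}\}$ of trial points generated by the algorithm up to iteration $k$, such that $\|x-x'\|<\delta$.
   Context: Problem. $D=[a,b]=\{x\in\mathbb{R}^N:a(j)\le x(j)\le b(j),\ 1\le j\le N\}$ is assumed to be an $N$-dimensional hypercube; $\|\cdot\|$ is the Euclidean norm; $f:D\to\mathbb{R}$ satisfies $|f(x')-f(x'')|\le L\|x'-x''\|$ on $D$ with an unknown constant $0<L<\infty$. The algorithm seeks the global minimum of $f$ on $D$. Points at which $f$ is evaluated are called trial points. Hyperintervals and subdivision. A hyperinterval $D_t=[a_t,b_t]$ is an axis-parallel box given by the endpoints $a_t,b_t$ of one of its main diagonals (the coordinates of $a_t$ need not be smaller than those of $b_t$); $f$ is evaluated at $a_t$ and $b_t$. To subdivide $D_t$, let $i$ be the smallest index $j$ for which $|b_t(j)-a_t(j)|$ is maximal. Let $u$ be the point obtained from $a_t$ by replacing its $i$-th coordinate by $a_t(i)+\frac23(b_t(i)-a_t(i))$, and $v$ the point obtained from $b_t$ by replacing its $i$-th coordinate by $b_t(i)+\frac23(a_t(i)-b_t(i))$. The function $f$ is evaluated at $u$ and $v$ (or the value is read from a database if it has already been computed), and $D_t$ is replaced by the three hyperintervals of equal volume with main diagonals $[a_t,v]$,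 $[u,v]$, $[u,b_t]$. Partitions and groups. $\{D^k\}$ is the current partition of $D$ at iteration $k$; initially, at $k=1$, it consists of $D=[a,b]$ only. Hyperintervals are put in groups according to the length of their main diagonals; a group is numbered by the index $l\ge0$, the number of successive subdivisions leading from $D$ to the hyperintervals of the group ($D$ has index $0$; the three hyperintervals obtained by subdividing a hyperinterval of group $l$ belong to group $l+1$; larger indices correspond to smaller hyperintervals). $q(k)$ and $Q(k)$ are the indices of the groups of the largest and of the smallest hyperintervals present in $\{D^k\}$, respectively. Non-domination. For $\tilde L>0$ put $R_i(\tilde L)=\frac12(f(a_i)+f(b_i)-\tilde L\|b_i-a_i\|)$. Among a considered collection of hyperintervals, $D_t$ is non-dominated with respect to $\tilde L$ if there is no $D_i$ in the collection with $R_i(\tilde L)<R_t(\tilde L)$; it is non-dominated if it is non-dominated with respect to some $0<\tilde L<\infty$. Further notation. $f_{min}(k)$ is the best function value (record) found after $k-1$ iterations, $x_{min}(k)$ a trial point where it is attained, $D_{min}(k)$ the hyperinterval of $\{D^k\}$ containing $x_{min}(k)$ (the smallest one if $x_{min}(k)$ is a common vertex of several hyperintervals), and $p(k)$ the index of the group containing $D_{min}(k)$. $f_{min}^{prec}$ is a stored old record. $\xi\ge0$ is a parameter of the algorithm, which can be set either independently of the record $f_{min}(k)$ or in relation with it (for example $\xi=\varepsilon|f_{min}(k)|$ with $\varepsilon\ge0$). The operation ''Process groups from $q(k)$ to $s$'' means: determine the non-dominated hyperintervals considering only the groups of $\{D^k\}$ with indices from $q(k)$ up to $s$; subdivide those hyperintervals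 $D_t$ that are non-dominated with respect to some $\tilde L>0$ for which $R_t(\tilde L)\le f_{min}(k)-\xi$; set $k:=k+1$ (with all quantities depending on $k$ updated accordingly). The improvement condition is $$f_{min}(k)\le f_{min}^{prec}-0.01\,|f_{min}^{prec}|.\qquad( * )$$ Algorithm. Step 1 (Initialization). Set $k:=1$, evaluate $f$ at $a$ and $b$, set $f_{min}(1):=\min\{f(a),f(b)\}$ and $q(1):=Q(1):=p(1):=0$. Step 2 (Local phase). Set $f_{min}^{prec}:=f_{min}(k)$. Step 2.1. Set $Lcounter:=1$ and $p':=p(k)$. Step 2.2. Set $p'':=\max\{p'-1,q(k)\}$. Step 2.3. Process groups from $q(k)$ to $p''$. Step 2.4. Set $Lcounter:=Lcounter+1$. If $Lcounter\le N$, go to Step 2.2; otherwise go to Step 2.5. Step 2.5. Set $p':=\max\{p',q(k)\}$. Process groups from $q(k)$ to $p'$. Step 3 (Switch). If $( * )$ holds, go to Step 2. Otherwise, if $p(k)<Q(k)$ or $q(k)=Q(k)$, go to Step 2.1 (keeping the old $f_{min}^{prec}$). Otherwise go to Step 4. Step 4 (Global phase). Set $f_{min}^{prec}:=f_{min}(k)$. Step 4.1. Set $Gcounter:=1$ and $p':=p(k)$. Step 4.2. Set $p':=\max\{p',q(k)\}$ and $r':=\lceil(q(k)+p')/2\rceil$. Step 4.3. Process groups from $q(k)$ to $r'$. Step 4.4. If $( * )$ holds, go to Step 2; otherwise go to Step 4.5. Step 4.5. Set $Gcounter:=Gcounter+1$. If $Gcounter\le2^{N+1}$, go to Step 4.2;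 otherwise go to Step 4.6. Step 4.6. Set $p':=\max\{p',q(k)\}$. Process groups from $q(k)$ to $p'$. Step 4.7. If $( * )$ holds, go to Step 2; otherwise go to Step 4.1 (keeping the old $f_{min}^{prec}$). The algorithm stops when the number of generated trial points reaches $T_{max}$; with $T_{max}=\infty$ it never stops and the number of iterations $k$ goes to infinity. *)

(* Defs.v *)
From HB Require Import structures.
From mathcomp Require Import all_boot all_order all_algebra.
From mathcomp Require Import boolp reals.

Set Implicit Arguments.
Unset Strict Implicit.
Unset Printing Implicit Defensive.

Import Order.TTheory GRing.Theory Num.Theory.
Local Open Scope ring_scope.

(* The norm MathComp-Analysis puts on row vectors is the sup norm. *)
Definition enorm (R : realType) (N : nat) (x : 'rV[R]_N) : R :=
  Num.sqrt (\sum_(j < N) x 0 j ^+ 2).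

(* The axis-parallel box one of whose main diagonals has endpoints a and b;
   a j <= b j is not required. *)
Definition box (R : realType) (N : nat) (a b : 'rV[R]_N) : {pred 'rV[R]_N} :=
  fun x => [forall j, Num.min (a 0 j) (b 0 j) <= x 0 j
                        <= Num.max (a 0 j) (b 0 j)].

Definition hypercube (R : realType) (N : nat) (a b : 'rV[R]_N) : Prop :=
  exists2 h : R, 0 < h & forall j, b 0 j - a 0 j = h.

Definition lipschitz_on (R : realType) (N : nat) (A : {pred 'rV[R]_N})
    (L : R) (f : 'rV[R]_N -> R) : Prop :=
  {in A &, forall x y, `|f x - f y| <= L * enorm (x - y)}.

(* ((a_t, b_t), l): the endpoints of the main diagonal and the number of
   successive subdivisions leading from D to this hyperinterval. *)
Definition hyperint (R : realType) (N : nat) : Type :=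
  ('rV[R]_N * 'rV[R]_N * nat)%type.

Definition lo (R : realType) (N : nat) (D : hyperint R N) : 'rV[R]_N := D.1.1.
Definition hi (R : realType) (N : nat) (D : hyperint R N) : 'rV[R]_N := D.1.2.
Definition gidx (R : realType) (N : nat) (D : hyperint R N) : nat := D.2.

Definition set_coord (R : realType) (N : nat) (x : 'rV[R]_N) (i : 'I_N) (c : R)
  : 'rV[R]_N := \row_j (if j == i then c else x 0 j).

(* The smallest index of a longest side; it exists as soon as 0 < N. *)
Definition split_coord (R : realType) (N : nat) (D : hyperint R N)
  : option 'I_N :=
  let side j := `|hi D 0 j - lo D 0 j| in
  [pick i | [forall j, side j <= side i]
            && [forall j : 'I_N, (j < i)%N ==> (side j < side i)]].

Definition point_u (R : realType) (N : nat) (D : hyperint R N) (i : 'I_N)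
  : 'rV[R]_N :=
  set_coord (lo D) i (lo D 0 i + 2 / 3 * (hi D 0 i - lo D 0 i)).

Definition point_v (R : realType) (N : nat) (D : hyperint R N) (i : 'I_N)
  : 'rV[R]_N :=
  set_coord (hi D) i (hi D 0 i + 2 / 3 * (lo D 0 i - hi D 0 i)).

Definition new_points (R : realType) (N : nat) (D : hyperint R N)
  : seq 'rV[R]_N :=
  if split_coord D is Some i then [:: point_u D i; point_v D i] else [::].

Definition subdivide (R : realType) (N : nat) (D : hyperint R N)
  : seq (hyperint R N) :=
  if split_coord D is Some i then
    let u := point_u D i in let v := point_v D i in
    [:: (lo D, v, (gidx D).+1);
        (u, v, (gidx D).+1);
        (u, hi D, (gidx D).+1)]
  else [:: D].

Definition Rbound (R : realType) (N : nat) (f : 'rV[R]_N -> R) (Lt : R)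
    (D : hyperint R N) : R :=
  2^-1 * (f (lo D) + f (hi D) - Lt * enorm (hi D - lo D)).

Definition nondominated_wrt (R : realType) (N : nat) (f : 'rV[R]_N -> R)
    (C : seq (hyperint R N)) (Lt : R) (D : hyperint R N) : Prop :=
  D \in C /\ ~ (exists2 D', D' \in C & Rbound f Lt D' < Rbound f Lt D).

(* The data at the beginning of iteration [niter]: the current partition, the
   points at which f has been evaluated during the previous iterations
   (repetitions are harmless), and the chosen point where the record is
   attained. *)
Record state (R : realType) (N : nat) := State {
  niter : nat;
  part : seq (hyperint R N);
  trials : seq 'rV[R]_N;
  xmin : 'rV[R]_N }.

Definition record_point (R : realType) (N : nat) (f : 'rV[R]_N -> R)
    (s : state R N) : Prop :=
  xmin s \in trials s /\ {in trials s, forall y, f (xmin s) <= f y}.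

Definition fmin (R : realType) (N : nat) (f : 'rV[R]_N -> R) (s : state R N)
  : R := f (xmin s).

Definition Qidx (R : realType) (N : nat) (s : state R N) : nat :=
  \max_(D <- part s) gidx D.

Definition qidx (R : realType) (N : nat) (s : state R N) : nat :=
  \big[minn/Qidx s]_(D <- part s) gidx D.

(* The group of the smallest hyperinterval containing the record point. *)
Definition pidx (R : realType) (N : nat) (s : state R N) : nat :=
  \max_(D <- part s | xmin s \in box (lo D) (hi D)) gidx D.

Definition considered (R : realType) (N : nat) (s : state R N) (m : nat)
  : seq (hyperint R N) :=
  [seq D <- part s | (qidx s <= gidx D <= m)%N].

Definition selected (R : realType) (N : nat) (f : 'rV[R]_N -> R) (xi : R)
    (s : state R N) (m : nat) (D : hyperint R N) : bool :=
  `[< exists Lt : R, [/\ 0 < Lt,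
        nondominated_wrt f (considered s m) Lt D
      & Rbound f Lt D <= fmin f s - xi] >].

(* "Process groups from q(k) to m".  The new record point may be any trial
   point attaining the new record. *)
Definition process (R : realType) (N : nat) (f : 'rV[R]_N -> R)
    (xi : nat -> R) (m : nat) (s s' : state R N) : Prop :=
  let sel := selected f (xi (niter s)) s m in
  [/\ niter s' = (niter s).+1,
      part s' = flatten [seq if sel D then subdivide D else [:: D]
                        | D <- part s],
      trials s' = trials s ++ flatten [seq new_points D | D <- part s & sel D]
    & record_point f s'].

Definition improved (R : realType) (N : nat) (f : 'rV[R]_N -> R) (fprec : R)
    (s : state R N) : bool :=
  fmin f s <= fprec - 1 / 100 * `|fprec|.

(* Control points of the algorithm, carrying its live local variables: the
   stored old record fprec, the counter (Lcounter or Gcounter) c, the index p',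
   and the index p'' or r' up to which groups are to be processed. *)
Inductive control (R : Type) : Type :=
| Step2
| Step2_1 (fprec : R)
| Step2_2 (fprec : R) (c p' : nat)
| Step2_3 (fprec : R) (c p' p'' : nat)
| Step2_4 (fprec : R) (c p' : nat)
| Step2_5 (fprec : R) (p' : nat)
| Step3 (fprec : R)
| Step4
| Step4_1 (fprec : R)
| Step4_2 (fprec : R) (c p' : nat)
| Step4_3 (fprec : R) (c p' r' : nat)
| Step4_4 (fprec : R) (c p' : nat)
| Step4_5 (fprec : R) (c p' : nat)
| Step4_6 (fprec : R) (p' : nat)
| Step4_7 (fprec : R).
Arguments Step2 {R}.
Arguments Step4 {R}.

Inductive step (R : realType) (N : nat) (f : 'rV[R]_N -> R) (xi : nat -> R)
  : state R N * control R -> state R N * control R -> Prop :=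
| step2 s :
    step f xi (s, Step2) (s, Step2_1 (fmin f s))
| step2_1 s fp :
    step f xi (s, Step2_1 fp) (s, Step2_2 fp 1 (pidx s))
(* p'.-1 is 0 instead of -1 for p' = 0, which does not change the maximum. *)
| step2_2 s fp c p' :
    step f xi (s, Step2_2 fp c p') (s, Step2_3 fp c p' (maxn p'.-1 (qidx s)))
| step2_3 s s' fp c p' p'' :
    process f xi p'' s s' ->
    step f xi (s, Step2_3 fp c p' p'') (s', Step2_4 fp c p')
| step2_4_again s fp c p' :
    (c.+1 <= N)%N ->
    step f xi (s, Step2_4 fp c p') (s, Step2_2 fp c.+1 p')
| step2_4_exit s fp c p' :
    ~~ (c.+1 <= N)%N ->
    step f xi (s, Step2_4 fp c p') (s, Step2_5 fp p')
| step2_5 s s' fp p' :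
    process f xi (maxn p' (qidx s)) s s' ->
    step f xi (s, Step2_5 fp p') (s', Step3 fp)
| step3_improved s fp :
    improved f fp s ->
    step f xi (s, Step3 fp) (s, Step2)
| step3_local s fp :
    ~~ improved f fp s -> (pidx s < Qidx s)%N \/ qidx s = Qidx s ->
    step f xi (s, Step3 fp) (s, Step2_1 fp)
| step3_global s fp :
    ~~ improved f fp s -> ~ ((pidx s < Qidx s)%N \/ qidx s = Qidx s) ->
    step f xi (s, Step3 fp) (s, Step4)
| step4 s :
    step f xi (s, Step4) (s, Step4_1 (fmin f s))
| step4_1 s fp :
    step f xi (s, Step4_1 fp) (s, Step4_2 fp 1 (pidx s))
| step4_2 s fp c p' :
    let p1 := maxn p' (qidx s) in
    step f xi (s, Step4_2 fp c p')
              (s, Step4_3 fp c p1 (uphalf (qidx s + p1)))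
| step4_3 s s' fp c p' r' :
    process f xi r' s s' ->
    step f xi (s, Step4_3 fp c p' r') (s', Step4_4 fp c p')
| step4_4_improved s fp c p' :
    improved f fp s ->
    step f xi (s, Step4_4 fp c p') (s, Step2)
| step4_4_continue s fp c p' :
    ~~ improved f fp s ->
    step f xi (s, Step4_4 fp c p') (s, Step4_5 fp c p')
| step4_5_again s fp c p' :
    (c.+1 <= 2 ^ N.+1)%N ->
    step f xi (s, Step4_5 fp c p') (s, Step4_2 fp c.+1 p')
| step4_5_exit s fp c p' :
    ~~ (c.+1 <= 2 ^ N.+1)%N ->
    step f xi (s, Step4_5 fp c p') (s, Step4_6 fp p')
| step4_6 s s' fp p' :
    process f xi (maxn p' (qidx s)) s s' ->
    step f xi (s, Step4_6 fp p') (s', Step4_7 fp)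
| step4_7_improved s fp :
    improved f fp s ->
    step f xi (s, Step4_7 fp) (s, Step2)
| step4_7_continue s fp :
    ~~ improved f fp s ->
    step f xi (s, Step4_7 fp) (s, Step4_1 fp).

Definition initial (R : realType) (N : nat) (a b : 'rV[R]_N)
    (f : 'rV[R]_N -> R) (s : state R N) : Prop :=
  [/\ niter s = 1%N, part s = [:: (a, b, 0%N)], trials s = [:: a; b]
    & record_point f s].

(* An execution without stopping rule (T_max = oo) on D = [a, b]. *)
Definition execution (R : realType) (N : nat) (a b : 'rV[R]_N)
    (f : 'rV[R]_N -> R) (xi : nat -> R) (run : nat -> state R N * control R)
  : Prop :=
  [/\ initial a b f (run 0%N).1, (run 0%N).2 = Step2
    & forall n, step f xi (run n) (run n.+1)].

(* One iteration spans several consecutive moves; the state is the same at all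
   times n with the same value of the iteration counter. *)
Definition trial_upto (R : realType) (N : nat)
    (run : nat -> state R N * control R) (k : nat) (x : 'rV[R]_N) : Prop :=
  exists2 n, niter (run n).1 = k & x \in trials (run n).1.

(* Main.v *)
Require Import Defs.
From mathcomp Require Import all_boot all_order all_algebra.
From mathcomp Require Import boolp reals.
From mathcomp Require Import ring lra.

Import Order.TTheory GRing.Theory Num.Theory.
Local Open Scope ring_scope.

(* After l = m N + r subdivisions (r < N) every hyperinterval of group l has
   its first r sides equal to h / 3^(m+1) and the others equal to h / 3^m, where
   h is the side of the hypercube D.  The length of the diagonal thus depends
   only on l, and decreases strictly to 0.  Whenever groups q(k), ..., m are
   processed, the best hyperinterval of the largest group q(k) is non-dominated
   with respect to every large enough constant, and its lower bound is then below
   any prescribed threshold, so it is subdivided.  Group q(k) therefore dies out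
   after finitely many iterations, q(k) tends to infinity, and x lies in
   hyperintervals of the partition of arbitrarily small diameter, whose vertices
   are trial points. *)

(** * Side lengths and diagonals of the groups *)

Section Sides.
Context {R : realType} {N : nat} (h : R).
Hypotheses (hN : (0 < N)%N) (h_gt0 : 0 < h).

Definition side (l j : nat) : R := h / 3 ^+ (l %/ N + (j < l %% N)%N).

Lemma side_gt0 l j : 0 < side l j.
Proof. by rewrite divr_gt0 // exprn_gt0. Qed.

(** Coordinates are cut cyclically: when [N] divides [l.+1], the last coordinate of the round is
    cut, the quotient grows and the remainder restarts at 0. *)
Lemma sideS l j : (j < N)%N ->
  side l.+1 j = if j == (l %% N)%N then side l j / 3 else side l j.
Proof using hN.
move=> jN; rewrite /side divnS // modnS.
have rN : (l %% N < N)%N by rewrite ltn_pmod.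
have divS3 m : h / 3 ^+ m.+1 = h / 3 ^+ m / 3.
  by rewrite exprSr invfM mulrA mulrAC.
case: ifPn => [dvdN|_].
  have rE : (l %% N).+1 = N.
    have : (N %| (l %% N).+1)%N.
      by rewrite /dvdn -[(l %% N).+1]addn1 modnDml addn1.
    by move=> /dvdn_leq -/(_ isT) le; apply/eqP; rewrite eqn_leq rN le.
  rewrite ltn0 addn0 add1n.
  case: eqP => [->|/eqP jr]; first by rewrite ltnn addn0.
  by rewrite ltn_neqAle jr -ltnS rE jN addn1.
rewrite add0n ltnS leq_eqVlt.
by case: eqP => [->|_] //=; rewrite ltnn addn0 addn1.
Qed.

Lemma side_le l j : side l j <= side l (l %% N).
Proof.
rewrite /side ltnn addn0 ler_pM2l // lef_pV2 ?posrE ?exprn_gt0 //.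
by rewrite ler_eXn2l ?leq_addr //; lra.
Qed.

Lemma side_lt l j : (j < l %% N)%N -> side l j < side l (l %% N).
Proof.
move=> jl; rewrite /side jl ltnn addn0 ltr_pM2l // ltf_pV2 ?posrE ?exprn_gt0 //.
by rewrite ltr_eXn2l ?addn1 //; lra.
Qed.

Definition diag (l : nat) : R := Num.sqrt (\sum_(j < N) side l j ^+ 2).

Lemma diag_gt0 l : 0 < diag l.
Proof.
rewrite sqrtr_gt0 (bigD1 (Ordinal hN)) //=.
by rewrite ltr_pwDl ?exprn_gt0 ?side_gt0 // sumr_ge0 // => i _; rewrite sqr_ge0.
Qed.

Lemma diagS l : diag l.+1 < diag l.
Proof.
pose r := Ordinal (ltn_pmod l hN).
rewrite ltr_sqrt; last first.
  by rewrite -sqrtr_gt0; exact: diag_gt0.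
rewrite (bigD1 r) //= [ltRHS](bigD1 r) //=.
apply: ltr_leD; last first.
  apply: ler_sum => j jr; rewrite sideS // -[X in _ == X]/(nat_of_ord r).
  by rewrite val_eqE (negPf jr).
have s_gt0 := side_gt0 l (l %% N).
by rewrite sideS ?ltn_pmod // eqxx ltr_pXn2r // ?nnegrE; lra.
Qed.

Lemma diag_lt l l' : (l < l')%N -> diag l' < diag l.
Proof.
apply: (homo_ltn (r := fun u v => v < u)) diagS l l' => y x z yx zy.
exact: lt_trans zy yx.
Qed.

Lemma diag_small (e : R) : 0 < e -> exists l, diag l < e.
Proof.
(* At [l = m * N] all sides equal [h / 3 ^+ m], so the squared diagonal is [N h^2 / 9^m]; this [m]
   ensures [N h^2 / e^2 < m <= 9^m]. *)
move=> e_gt0; pose m := Num.bound (N%:R * h ^+ 2 / e ^+ 2).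
exists (m * N)%N.
rewrite -(@ltr_pXn2r _ 2) ?nnegrE ?sqrtr_ge0 ?(ltW e_gt0) //.
rewrite sqr_sqrtr; last by apply: sumr_ge0 => i _; rewrite sqr_ge0.
under eq_bigr => j _ do rewrite /side mulnK // modnMl ltn0 addn0.
rewrite sumr_const card_ord -[ltLHS]mulr_natl expr_div_n mulrA -exprM muln2.
rewrite ltr_pdivrMr ?exprn_gt0 // [ltRHS]mulrC -ltr_pdivrMr ?exprn_gt0 //.
have Nh_ge0 : 0 <= N%:R * h ^+ 2 / e ^+ 2.
  by rewrite divr_ge0 ?sqr_ge0 // mulr_ge0 ?ler0n ?sqr_ge0.
apply: lt_le_trans (archi_boundP Nh_ge0) _.
rewrite -/m -natrX ler_nat -muln2.
apply: leq_trans (ltnW (ltn_expl m (isT : (1 < 3)%N))) _.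
by rewrite leq_exp2l // leq_pmulr.
Qed.

End Sides.

(** * Geometry of one subdivision *)

Lemma between_minmax {R : realType} (s t y : R) :
  (Num.min s t <= y <= Num.max s t) = (s <= y <= t) || (t <= y <= s).
Proof.
by rewrite ge_min le_max; case: (leP s y); case: (leP y s);
  case: (leP t y); case: (leP y t) => //=; lra.
Qed.

(** From [s] to [t] the points come in the order [s], [q], [p], [t], whichever endpoint is larger,
    so the three pieces leave no gap. *)
Lemma between_thirds {R : realType} (s t y : R)
    (p := s + 2 / 3 * (t - s)) (q := t + 2 / 3 * (s - t)) :
  Num.min s t <= y <= Num.max s t ->
  [\/ Num.min s q <= y <= Num.max s q, Num.min p q <= y <= Num.max p q
    | Num.min p t <= y <= Num.max p t].
Proof.
rewrite !between_minmax {}/p {}/q => /orP[] /andP[sy yt];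
  have [yq|qy] := leP y (t + 2 / 3 * (s - t));
  have [yp|py] := leP y (s + 2 / 3 * (t - s));
  by [apply: Or31; lra | apply: Or32; lra | apply: Or33; lra].
Qed.

Section Subdivision.
Context {R : realType} {N : nat} (h : R).
Hypotheses (hN : (0 < N)%N) (h_gt0 : 0 < h).
Implicit Types (D : hyperint R N) (x : 'rV[R]_N).

Definition regular D : Prop :=
  forall j, `|hi D 0 j - lo D 0 j| = side (N := N) h (gidx D) j.

Lemma enorm_regular D : regular D ->
  enorm (hi D - lo D) = diag (N := N) h (gidx D).
Proof.
move=> regD; congr (Num.sqrt _); apply: eq_bigr => j _.
by rewrite -regD !mxE -normrX ger0_norm // sqr_ge0.
Qed.

(** The coordinates before [gidx D %% N] were already cut in the current round and are strictly
    shorter, so the smallest-index rule singles out this one. *)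
Lemma split_coord_regular D : regular D ->
  split_coord D = Some (Ordinal (ltn_pmod (gidx D) hN)).
Proof using h_gt0.
move=> regD; set r := Ordinal _.
have le_r j : `|hi D 0 j - lo D 0 j| <= `|hi D 0 r - lo D 0 r|.
  by rewrite !regD side_le.
have lt_r (j : 'I_N) : (j < r)%N ->
    `|hi D 0 j - lo D 0 j| < `|hi D 0 r - lo D 0 r|.
  by move=> jr; rewrite !regD side_lt.
rewrite /split_coord; case: pickP => [i /andP[/forallP le_i /forallP lt_i]|].
  congr Some; apply: val_inj; case: (ltngtP i r) => // [ir|ri].
    by have := lt_le_trans (lt_r _ ir) (le_i r); rewrite ltxx.
  by have := lt_le_trans (implyP (lt_i r) ri) (le_r i); rewrite ltxx.
move=> /(_ r) /negP[]; apply/andP; split; apply/forallP => j //.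
by apply/implyP; exact: lt_r.
Qed.

Lemma subdivide_regular D D' : regular D -> D' \in subdivide D -> regular D'.
Proof using hN h_gt0.
move=> regD; rewrite /subdivide split_coord_regular //.
set r := Ordinal _ => D'_in j.
have sideE : side (N := N) h (gidx D).+1 j =
    if j == r then `|hi D 0 j - lo D 0 j| / 3 else `|hi D 0 j - lo D 0 j|.
  by rewrite sideS // regD.
have norm3 (c : R) : `|c| / 3 = `|c / 3| by rewrite normf_div normr_nat.
move: D'_in; rewrite !inE => /or3P[] /eqP->;
  rewrite /gidx /= -/(gidx D) sideE /lo /hi /= -/(lo D) -/(hi D) !mxE.
- by case: eqP => [->|_] //; rewrite norm3; congr `|_|; field.
(* In the middle piece [v - u] is minus one third of the old side, hence the change of sign. *)
- by case: eqP => [->|_] //; rewrite norm3 -normrN; congr `|_|; field.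
- by case: eqP => [->|_] //; rewrite norm3; congr `|_|; field.
Qed.

Lemma gidx_subdivide D D' : regular D -> D' \in subdivide D ->
  gidx D' = (gidx D).+1.
Proof using hN h_gt0.
move=> regD; rewrite /subdivide split_coord_regular //.
by rewrite !inE => /or3P[] /eqP->.
Qed.

Lemma vertices_subdivide D D' : regular D -> D' \in subdivide D ->
  {subset [:: lo D'; hi D'] <= [:: lo D; hi D] ++ new_points D}.
Proof using hN h_gt0.
move=> regD; rewrite /subdivide /new_points split_coord_regular //.
rewrite !inE => /or3P[] /eqP-> y; rewrite !inE => /orP[] /eqP->;
  by rewrite /lo /hi /= eqxx ?orbT.
Qed.

Lemma box_subdivide D x : regular D -> x \in box (lo D) (hi D) ->
  exists2 D', D' \in subdivide D & x \in box (lo D') (hi D').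
Proof using hN h_gt0.
move=> regD /forallP xD; rewrite /subdivide split_coord_regular //.
set r := Ordinal _.
(* Only coordinate [r] needs checking: elsewhere the endpoints of each piece agree with those of
   [D]. *)
have piece (y z : 'rV[R]_N) :
    (forall j, j != r -> y 0 j = lo D 0 j) ->
    (forall j, j != r -> z 0 j = hi D 0 j) ->
    Num.min (y 0 r) (z 0 r) <= x 0 r <= Num.max (y 0 r) (z 0 r) ->
    x \in box y z.
  move=> yE zE xr; apply/forallP => j; have [->//|jr] := eqVneq j r.
  by rewrite yE // zE.
have off c (y : 'rV[R]_N) j : j != r -> set_coord y r c 0 j = y 0 j.
  by move=> /negPf jr; rewrite mxE jr.
have at_r c (y : 'rV[R]_N) : set_coord y r c 0 r = c by rewrite mxE eqxx.
case: (between_thirds _ _ _ (xD r)) => xr.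
- exists (lo D, point_v D r, (gidx D).+1); first by rewrite !inE eqxx.
  by apply: piece => //= [j /off->|]; rewrite ?at_r.
- exists (point_u D r, point_v D r, (gidx D).+1).
    by rewrite !inE eqxx orbT.
  by apply: piece => /= [j /off->|j /off->|]; rewrite ?at_r.
- exists (point_u D r, hi D, (gidx D).+1); first by rewrite !inE eqxx !orbT.
  by apply: piece => //= [j /off->|]; rewrite ?at_r.
Qed.

Lemma enorm_box D x : x \in box (lo D) (hi D) ->
  enorm (x - lo D) <= enorm (hi D - lo D).
Proof.
move=> /forallP xD; rewrite ler_wsqrtr // ler_sum // => j _.
rewrite !mxE -[leLHS]real_normK ?num_real // -[leRHS]real_normK ?num_real //.
rewrite lerXn2r ?nnegrE //.
have := xD j; rewrite between_minmax; case: (ler0P (x 0 j - lo D 0 j));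
  by case: (ler0P (hi D 0 j - lo D 0 j)) => ? ? /orP[] /andP[? ?]; lra.
Qed.

End Subdivision.

(** * Minimizers, common thresholds and counting in finite lists *)

Section Lists.

Lemma seq_argmin {R : realType} {T : eqType} (P : pred T) (g : T -> R)
    (s : seq T) : has P s ->
  exists x, [/\ x \in s, P x & forall y, y \in s -> P y -> g x <= g y].
Proof.
elim: s => // z s IHs /=.
have [/IHs[x [xs Px x_le]] _|/hasPn noP] := boolP (has P s); last first.
  rewrite orbF => Pz; exists z; split; rewrite ?mem_head // => y.
  by rewrite inE => /orP[/eqP->//|/noP/negPf->].
have [Pz|/negPf nPz] := boolP (P z); last first.
  exists x; split; rewrite ?inE ?xs ?orbT // => y.
  by rewrite inE => /orP[/eqP->|/x_le//]; rewrite nPz.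
have [xz|/ltW zx] := leP (g x) (g z).
  exists x; split; rewrite ?inE ?xs ?orbT // => y.
  by rewrite inE => /orP[/eqP->|/x_le].
exists z; split; rewrite ?mem_head // => y.
by rewrite inE => /orP[/eqP->//|/x_le xy /xy]; exact: le_trans.
Qed.

Lemma seq_eventually {R : realType} {T : eqType} (P : T -> R -> Prop)
    (s : seq T) :
  (forall x, x \in s -> exists M, forall c, M <= c -> P x c) ->
  exists M, forall c, M <= c -> forall x, x \in s -> P x c.
Proof.
elim: s => [|z s IHs] ev; first by exists 0.
have [|M PM] := IHs; first by move=> x xs; apply: ev; rewrite inE xs orbT.
have [Mz Pz] := ev z (mem_head _ _).
exists (Num.max M Mz) => c; rewrite ge_max => /andP[Mc Mzc] x.
by rewrite inE => /orP[/eqP->|xs]; [exact: Pz|exact: PM].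
Qed.

Lemma count_flatten_lt {T : eqType} (p : pred T) (F : T -> seq T) (s : seq T) :
  (forall x, x \in s -> (count p (F x) <= p x)%N) ->
  (exists2 x, x \in s & (count p (F x) < p x)%N) ->
  (count p (flatten [seq F x | x <- s]) < count p s)%N.
Proof.
have count_le (t : seq T) : (forall x, x \in t -> (count p (F x) <= p x)%N) ->
    (count p (flatten [seq F x | x <- t]) <= count p t)%N.
  elim: t => // y t IHt le /=; rewrite count_cat leq_add ?le ?mem_head //.
  by apply: IHt => x xt; rewrite le // inE xt orbT.
elim: s => [|y s IHs] le [x]; first by rewrite in_nil.
have le_s z : z \in s -> (count p (F z) <= p z)%N.
  by move=> zs; rewrite le // inE zs orbT.
rewrite inE /= count_cat => /orP[/eqP-> lt_y|xs lt_x].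
  by rewrite -addSn leq_add ?count_le.
by rewrite -addnS leq_add ?le ?mem_head //; apply: IHs => //; exists x.
Qed.

End Lists.

(** * Invariant of the partition and effect of one processing of groups *)

Section Progress.
Context {R : realType} {N : nat} (a b : 'rV[R]_N) (f : 'rV[R]_N -> R) (h : R).
Hypotheses (hN : (0 < N)%N) (h_gt0 : 0 < h).
Implicit Types (s : state R N) (D : hyperint R N).

(** For the final argument, the third clause yields a hyperinterval around the target point, the
    second makes its vertices trial points, and the first controls its diameter. *)
Definition sound s : Prop :=
  [/\ forall D, D \in part s -> regular h D,
      forall D, D \in part s -> {subset [:: lo D; hi D] <= trials s}
    & forall x, x \in box a b ->
        exists2 D, D \in part s & x \in box (lo D) (hi D)].

Lemma sound_initial s : (forall j, b 0 j - a 0 j = h) ->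
  initial a b f s -> sound s.
Proof using h_gt0.
move=> hD [_ partE trialsE _]; split; rewrite partE ?trialsE.
- move=> D; rewrite inE => /eqP-> j.
  by rewrite /side div0n mod0n ltn0 expr0 divr1 /lo /hi /= hD gtr0_norm.
- by move=> D; rewrite inE => /eqP->.
- by move=> x xab; exists (a, b, 0%N); rewrite ?inE.
Qed.

Lemma part_process xi m s s' D' : process f xi m s s' -> D' \in part s' ->
  exists2 D, D \in part s &
    if selected f (xi (niter s)) s m D then D' \in subdivide D else D' == D.
Proof.
move=> [_ -> _ _] /flatten_mapP[D Ds D'D]; exists D => //.
by move: D'D; case: ifP => // _; rewrite inE.
Qed.

Lemma sound_process xi m s s' : process f xi m s s' -> sound s -> sound s'.
Proof using hN h_gt0.
move=> pr [reg vert cover]; have [_ partE trialsE _] := pr; split.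
- move=> D' /(part_process _ _ _ _ _ pr)[D Ds].
  case: ifP => _ D'D; last by rewrite (eqP D'D); exact: reg.
  exact: subdivide_regular (reg D Ds) D'D.
- move=> D' /(part_process _ _ _ _ _ pr)[D Ds]; rewrite trialsE.
  case: ifP => selD D'D y; last first.
    by rewrite (eqP D'D) => /(vert D Ds) ys; rewrite mem_cat ys.
  move=> /(vertices_subdivide h hN h_gt0 D D' (reg D Ds) D'D).
  rewrite !mem_cat => /orP[/(vert D Ds)->//|yD]; apply/orP; right.
  by apply/flatten_mapP; exists D; rewrite // mem_filter selD.
- move=> x /cover[D Ds xD]; rewrite partE.
  case: (boolP (selected f (xi (niter s)) s m D)) => selD.
    have [D' D'D xD'] := box_subdivide h hN h_gt0 D x (reg D Ds) xD.
    by exists D' => //; apply/flatten_mapP; exists D; rewrite ?selD.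
  by exists D => //; apply/flatten_mapP; exists D; rewrite ?(negPf selD) ?inE.
Qed.

Lemma qidx_eq s l : (forall D, D \in part s -> (l <= gidx D)%N) ->
  (exists2 D, D \in part s & gidx D = l) -> qidx s = l.
Proof.
move=> l_le [D Ds Dl]; apply/eqP; rewrite eqn_leq; apply/andP; split.
  (* The default value [Qidx s] is generalized, since it depends on the list under induction. *)
  rewrite -Dl /qidx; elim: (part s) (Qidx s) Ds => // D' t IHt Q.
  rewrite inE big_cons geq_min => /orP[/eqP->|/IHt->]; first by rewrite leqnn.
  by rewrite orbT.
rewrite /qidx big_seq; apply: (big_ind (fun n => (l <= n)%N)) => //.
(* The default value of the minimum is at least [l] too, being a maximum over a list containing
   [D]. *)
- by rewrite -Dl; exact: leq_bigmax_seq.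
- by move=> m n lm ln; rewrite leq_min lm ln.
Qed.

Lemma selected_largest (c : R) m s l : sound s -> (l <= m)%N ->
  (forall D, D \in part s -> (l <= gidx D)%N) ->
  (exists2 D, D \in part s & gidx D = l) ->
  exists D, [/\ D \in part s, gidx D = l & selected f c s m D].
Proof using hN h_gt0.
move=> [reg _ _] lm l_le exl; have ql := qidx_eq s l l_le exl.
(* Diagonals within group [l] are equal, so minimizing the sum of the two values minimizes [Rbound]
   for every constant at once. *)
have [|D [Ds /eqP Dl D_min]] := seq_argmin (fun D => gidx D == l)
    (fun D => f (lo D) + f (hi D)) (part s).
  by have [D Ds Dl] := exl; apply/hasP; exists D; rewrite // Dl.
exists D; split=> //; apply/asboolP.
have ev D' : D' \in part s -> exists M, forall t, M <= t ->
    Rbound f t D <= Rbound f t D'.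
  move=> D's; have := l_le D' D's.
  rewrite leq_eqVlt => /orP[/eqP lD'|lD'].
    exists 0 => t _.
    rewrite /Rbound !(enorm_regular h) ?Dl -?lD'; try exact: reg.
    by rewrite ler_pM2l ?invr_gt0 // lerD2r D_min // lD'.
  have d_lt := diag_lt h hN h_gt0 _ _ lD'; rewrite -subr_gt0 in d_lt.
  (* At this constant the two bounds coincide; beyond it the longer diagonal of [D] makes its bound
     the smaller one. *)
  exists ((f (lo D) + f (hi D) - (f (lo D') + f (hi D')))
          / (diag (N := N) h l - diag (N := N) h (gidx D'))) => t.
  rewrite ler_pdivrMr // => t_ge.
  rewrite /Rbound !(enorm_regular h) ?Dl; try exact: reg.
  by rewrite ler_pM2l ?invr_gt0 //; lra.
have [M M_dom] := seq_eventually _ _ ev.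
have d_gt0 := diag_gt0 h hN h_gt0 l.
(* From [e / diag l] on, the bound of [D] is at most [fmin f s - c]; in [t], the 1 gives positivity
   and [M] non-domination. *)
pose e := f (lo D) + f (hi D) - 2 * (fmin f s - c).
pose t := Num.max 1 (Num.max M (e / diag (N := N) h l)).
have [t1 tM te] : [/\ 1 <= t, M <= t & e / diag (N := N) h l <= t].
  by rewrite !le_max !lexx !orbT.
exists t; split; first exact: lt_le_trans t1.
- split; first by rewrite mem_filter ql Dl leqnn lm.
  move=> [D']; rewrite mem_filter => /andP[_ /(M_dom t tM)].
  by rewrite leNgt => /negP.
- rewrite /Rbound (enorm_regular h) ?Dl; last exact: reg.
  by move: te; rewrite ler_pdivrMr // /e; lra.
Qed.

(** Pieces have index above [l], so nothing enters the smallest-index group, while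
    [selected_largest] forces at least one member out. *)
Lemma process_progress xi m s s' l : process f xi m s s' -> sound s ->
  (qidx s <= m)%N -> (forall D, D \in part s -> (l <= gidx D)%N) ->
  (exists2 D, D \in part s & gidx D = l) ->
  (forall D, D \in part s' -> (l <= gidx D)%N) /\
  (count (fun D => gidx D == l) (part s')
     < count (fun D => gidx D == l) (part s))%N.
Proof using hN h_gt0.
move=> pr snd qm l_le exl; have [reg _ _] := snd; split.
  move=> D' /(part_process _ _ _ _ _ pr)[D Ds].
  case: ifP => _ D'D; last by rewrite (eqP D'D) l_le.
  by rewrite (gidx_subdivide _ _ _ _ _ (reg D Ds) D'D) // ltnW // ltnS l_le.
have [_ -> _ _] := pr.
have none D : D \in part s ->
    count (fun D => gidx D == l) (subdivide D) = 0%N.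
  move=> Ds; apply/eqP; rewrite -leqn0 leqNgt -has_count -all_predC.
  apply/allP => D' /(gidx_subdivide _ _ _ _ _ (reg D Ds)) D'_idx /=.
  by rewrite D'_idx // gtn_eqF // ltnS l_le.
have [|D [Ds Dl selD]] := selected_largest (xi (niter s)) m s l snd _ l_le exl.
  by rewrite -(qidx_eq s l).
apply: count_flatten_lt => [D' D's|].
  by case: ifP => _; rewrite ?none //= addn0.
by exists D; rewrite // selD none // Dl eqxx.
Qed.

End Progress.

(** * Infinite executions: iterations never stall and every group dies out *)

Section Execution.
Context {R : realType} {N : nat} (a b : 'rV[R]_N) (f : 'rV[R]_N -> R) (h : R).
Context (xi : nat -> R) (run : nat -> state R N * control R).
Hypotheses (hN : (0 < N)%N) (h_gt0 : 0 < h).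
Hypotheses (hD : forall j, b 0 j - a 0 j = h) (hrun : execution a b f xi run).

(** At these two control points the processing bound was computed by an earlier move, so its
    comparison with [qidx] has to be carried as an invariant. *)
Definition bound_ok (sc : state R N * control R) : Prop :=
  match sc.2 with
  | Step2_3 _ _ _ m | Step4_3 _ _ _ m => (qidx sc.1 <= m)%N
  | _ => True
  end.

(* The number of moves before the next processing of groups is at most this. *)
Definition delay (c : control R) : nat :=
  match c with
  | Step2_3 _ _ _ _ | Step2_5 _ _ | Step4_3 _ _ _ _ | Step4_6 _ _ => 0
  | Step2_2 _ _ _ | Step4_2 _ _ _ => 1
  | Step2_1 _ | Step2_4 _ _ _ | Step4_1 _ | Step4_5 _ _ _ => 2
  | Step2 | Step4 => 3
  | Step3 _ | Step4_4 _ _ _ | Step4_7 _ => 4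
  end.

Lemma step_cases sc sc' : step f xi sc sc' -> bound_ok sc ->
  bound_ok sc' /\
  ((sc'.1 = sc.1 /\ (delay sc'.2 < delay sc.2)%N) \/
   exists2 m, (qidx sc.1 <= m)%N & process f xi m sc.1 sc'.1).
Proof.
rewrite /bound_ok; case=> //=; try by [move=> *; split; auto].
- by move=> s fp c p' _; rewrite leq_maxr; split; auto.
- by move=> s s' fp c p' m pr qm; split=> //; right; exists m.
- by move=> s s' fp p' pr _; split=> //; right;
    exists (maxn p' (qidx s)); rewrite ?leq_maxr.
- move=> s fp c p' _; split; last by left.
  (* The rounded-up mean of [qidx s] and [maxn p' (qidx s)] is at least [qidx s]. *)
  by rewrite geq_uphalf_double -addnn leqW // leq_add2l leq_maxr.
- by move=> s s' fp c p' m pr qm; split=> //; right; exists m.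
- by move=> s s' fp p' pr _; split=> //; right;
    exists (maxn p' (qidx s)); rewrite ?leq_maxr.
Qed.

Lemma run_bound_ok n : bound_ok (run n).
Proof using hrun.
case: hrun => _ c0 st; elim: n => [|n IHn]; first by rewrite /bound_ok c0.
by have [] := step_cases _ _ (st n) IHn.
Qed.

Lemma run_step n :
  ((run n.+1).1 = (run n).1 /\ (delay (run n.+1).2 < delay (run n).2)%N) \/
  exists2 m, (qidx (run n).1 <= m)%N & process f xi m (run n).1 (run n.+1).1.
Proof using hrun.
by case: hrun => _ _ st; have [] := step_cases _ _ (st n) (run_bound_ok n).
Qed.

(** A move without processing strictly lowers [delay], so only finitely many can occur in a row. *)
Lemma next_process n : exists n', [/\ (n <= n')%N, (run n').1 = (run n).1 &
  exists2 m, (qidx (run n').1 <= m)%N &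
    process f xi m (run n').1 (run n'.+1).1].
Proof using hrun.
have [d] := ubnP (delay (run n).2); elim: d n => // d IHd n.
rewrite ltnS => le_d.
have [[sE lt_d]|pr] := run_step n; last by exists n.
have [n' [nn' s'E pr]] := IHd n.+1 (leq_trans lt_d le_d).
by exists n'; split; [exact: ltnW|rewrite s'E|].
Qed.

Lemma sound_run n : sound a b h (run n).1.
Proof using hN h_gt0 hD hrun.
elim: n => [|n IHn].
  by case: hrun => ini _ _; exact: sound_initial ini.
have [[-> _]//|[m _ pr]] := run_step n.
exact: sound_process pr IHn.
Qed.

Lemma trials_run n n' : (n <= n')%N ->
  {subset trials (run n).1 <= trials (run n').1}.
Proof using hrun.
elim: n' => [|n' IHn']; first by rewrite leqn0 => /eqP->.
rewrite leq_eqVlt => /orP[/eqP->//|/IHn' sub] x /sub xn'.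
have [[-> _]//|[m _ [_ _ -> _]]] := run_step n'.
by rewrite mem_cat xn'.
Qed.

(** The counter rises by exactly one at each processing, and processings recur forever, so no later
    value is skipped. *)
Lemma niter_run n k : (niter (run n).1 <= k)%N ->
  exists2 n', (n <= n')%N & niter (run n').1 = k.
Proof using hrun.
elim: k => [|k IHk]; first by rewrite leqn0 => /eqP; exists n.
rewrite leq_eqVlt => /orP[/eqP|/IHk[n1 nn1 k1]]; first by exists n.
have [n2 [n12 s2E [m _ [itE _ _ _]]]] := next_process n1.
exists n2.+1; first by rewrite (leq_trans nn1) // (leq_trans n12).
by rewrite itE s2E k1.
Qed.

Lemma largest_group_run l :
  exists n, forall D, D \in part (run n).1 -> (l <= gidx D)%N.
Proof using hN h_gt0 hD hrun.
elim: l => [|l [n]]; first by exists 0%N.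
(* Inner induction on the number of hyperintervals left in group [l]; once none is left, all indices
   exceed [l]. *)
have [c] := ubnP (count (fun D => gidx D == l) (part (run n).1)).
elim: c n => // c IHc n; rewrite ltnS => le_c l_le.
have [/hasP[D Ds /eqP Dl]|/hasPn no_l] :=
    boolP (has (fun D => gidx D == l) (part (run n).1)); last first.
  by exists n => D Ds; rewrite ltn_neqAle eq_sym no_l //= l_le.
have [n' [_ sE [m qm pr]]] := next_process n; rewrite sE in qm pr.
have [] := process_progress a b f h hN h_gt0 _ _ _ _ l pr (sound_run n) qm l_le.
  by exists D.
move=> l_le' lt_c; apply: (IHc n'.+1) => //; exact: leq_trans lt_c le_c.
Qed.

End Execution.

(* The parameter xi k is the one used at iteration k: it may be constant, or
   depend on the record, e.g. xi k = eps * |fmin k|. *)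
Theorem theorem3p1 (R : realType) (N : nat) (hN : (0 < N)%N)
    (a b : 'rV[R]_N) (hD : hypercube a b)
    (f : 'rV[R]_N -> R) (L : R) (hL : 0 < L)
    (hf : lipschitz_on (box a b) L f)
    (xi : nat -> R) (hxi : forall k : nat, 0 <= xi k)
    (run : nat -> state R N * control R) (hrun : execution a b f xi run)
    (x : 'rV[R]_N) (hx : x \in box a b) (delta : R) (hdelta : 0 < delta) :
  exists kdelta : nat, (1 <= kdelta)%N /\
    exists x' : 'rV[R]_N,
      (forall k : nat, (kdelta < k)%N -> trial_upto run k x') /\
      enorm (x - x') < delta.
Proof.
have [h h_gt0 hD'] := hD.
have [l diag_l] := diag_small h hN _ hdelta.
have [n l_le] := largest_group_run a b f h xi run hN h_gt0 hD' hrun l.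
have [reg vert cover] := sound_run a b f h xi run hN h_gt0 hD' hrun n.
have [D Ds xD] := cover x hx.
(* The successor makes [1 <= kdelta] immediate; the vertex [lo D] is already a trial point at time
   [n] and stays one. *)
exists (niter (run n).1).+1; split=> //; exists (lo D); split.
  move=> k /ltnW/ltnW k_ge.
  have [n' nn' n'k] := niter_run a b f xi run hrun n k k_ge.
  exists n' => //; apply: (trials_run a b f xi run hrun _ _ nn').
  by apply: (vert D Ds); rewrite mem_head.
apply: le_lt_trans (enorm_box _ _ xD) _; rewrite (enorm_regular h); last exact: reg.
have := l_le D Ds; rewrite leq_eqVlt => /orP[/eqP<-//|lD].
exact: lt_trans (diag_lt h hN h_gt0 _ _ lD) diag_l.
Qed.
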